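(* Let $(S,+,\cdot,-,\ast)$ be a weak left $\star$-brace. Then the map $$r_S: S\times S\to S\times S,\qquad r_S(x,y)=\bigl(x(x^{\ast}+y),\ (x^{\ast}+y)^{\ast}y\bigr)$$ is a set-theoretic solution of the Yang-Baxter equation.
   Context: A regular $\star$-semigroup is a triple $(S,\cdot,\ast)$ where $(S,\cdot)$ is a semigroup on a non-empty set and $\ast:S\to S$, $x\mapsto x^\ast$, satisfies $xx^\ast x=x$, $(x^\ast)^\ast=x$, $(xy)^\ast=y^\ast x^\ast$ for all $x,y\in S$. A weak left $\star$-brace is $(S,+,\cdot,-,\ast)$ where $(S,+,-)$ and $(S,\cdot,\ast)$ are regular $\star$-semigroups on the same set $S$ (the unary operation of $(S,+)$ is $x\mapsto -x$, that of $(S,\cdot)$ is $x\mapsto x^\ast$; the addition need not be commutative) such that for all $x,y,z\in S$: $x(y+z)=xy-x+xz$ and $-x+x=xx^\ast$. Here multiplication has precedence over addition and $x-y$ means $x+(-y)$. A map $r:S\times S\to S\times S$ is a set-theoretic solution of the Yang-Baxter equation if $(r\times \mathrm{id}_S)(\mathrm{id}_S\times r)(r\times \mathrm{id}_S)=(\mathrm{id}_S\times r)(r\times \mathrm{id}_S)(\mathrm{id}_S\times r)$ as maps $S^3\to S^3$ (no bijectivity is required). *)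

(* Defs.v *)
From mathcomp Require Import ssreflect ssrfun.

Set Implicit Arguments.
Unset Strict Implicit.
Unset Printing Implicit Defensive.

Record regular_star_semigroup (S : Type) (op : S -> S -> S) (star : S -> S)
    : Prop := RegularStarSemigroup {
  rss_inhabited : inhabited S;
  rss_assoc : associative op;
  rss_regular : forall x, op (op x (star x)) x = x;
  rss_involutive : involutive star;
  rss_antimorph : forall x y, star (op x y) = op (star y) (star x)
}.

(* The addition is not assumed commutative, so additive notation from the
   algebraic hierarchy is not available and the operations are kept explicit. *)
Record weak_left_star_brace (S : Type)
    (add mul : S -> S -> S) (opp star : S -> S) : Prop := WeakLeftStarBrace {
  wlsb_add : regular_star_semigroup add opp;
  wlsb_mul : regular_star_semigroup mul star;
  (* x (y + z) = x y - x + x z *)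
  wlsb_distr : forall x y z,
    mul x (add y z) = add (add (mul x y) (opp x)) (mul x z);
  (* - x + x = x x^* *)
  wlsb_compat : forall x, add (opp x) x = mul x (star x)
}.

Definition map_left (S : Type) (r : S * S -> S * S) (t : S * S * S)
    : S * S * S :=
  let: (x, y, z) := t in let: (u, v) := r (x, y) in (u, v, z).

Definition map_right (S : Type) (r : S * S -> S * S) (t : S * S * S)
    : S * S * S :=
  let: (x, y, z) := t in let: (u, v) := r (y, z) in (x, u, v).

Definition yang_baxter_solution (S : Type) (r : S * S -> S * S) : Prop :=
  map_left r \o map_right r \o map_left r
    =1 map_right r \o map_left r \o map_right r.

(* (x, y) |-> (x (x^* + y), (x^* + y)^* y) *)
Definition brace_map (S : Type) (add mul : S -> S -> S) (star : S -> S)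
    (p : S * S) : S * S :=
  let: (x, y) := p in
  (mul x (add (star x) y), mul (star (add (star x) y)) y).

(* Main.v *)
Require Import Defs.
From mathcomp Require Import ssreflect ssrfun.

(* Write lam x y = x (x^* + y) = - x + x y and rho y x = (x^* + y)^* y, so that
   r (x, y) = (lam x y, rho y x). Call e = e e^* a projection; additive and
   multiplicative projections coincide because - x + x = x x^*. One shows that
   lam x e = x e x^* for a projection e, whence f w = w + f and then
   w + z + f = w + f + z + f for a projection f. So h is the identity, and every
   projection is central, in the additive monoid h + S + h. These facts give
   lam x (lam y z) = lam (x y) z, lam x y * rho y x = x y and
   rho z (rho y x) = rho (y z) x, which settle the outer components of the braid
   relation. The middle components are rewritten as t^* s s^* (s + p) and
   t^* (t - p + y z), with p = lam y z, s = x^* + y and t = x^* + p, and are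
   compared inside h + S + h for h = y y^*. *)

Set Implicit Arguments.
Unset Strict Implicit.
Unset Printing Implicit Defensive.

Section WeakLeftStarBrace.

Context (S : Type) (add mul : S -> S -> S) (opp star : S -> S).
Context (brS : weak_left_star_brace add mul opp star).

Local Notation "x + y" := (add x y).
Local Notation "x * y" := (mul x y).
Local Notation "- x" := (opp x).
Local Notation "x - y" := (add x (opp y)).
Local Notation "x ^*" := (star x).

(** * The axioms and their immediate consequences *)

Let addA x y z : x + (y + z) = x + y + z.
Proof. exact: (rss_assoc (wlsb_add brS)). Qed.
Let mulA x y z : x * (y * z) = x * y * z.
Proof. exact: (rss_assoc (wlsb_mul brS)). Qed.
Let oppK x : - - x = x.
Proof. exact: (rss_involutive (wlsb_add brS)). Qed.
Let starK x : x^*^* = x.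
Proof. exact: (rss_involutive (wlsb_mul brS)). Qed.
Let oppD x y : - (x + y) = - y - x.
Proof. exact: (rss_antimorph (wlsb_add brS)). Qed.
Let starM x y : (x * y)^* = y^* * x^*.
Proof. exact: (rss_antimorph (wlsb_mul brS)). Qed.
Let addNK x : x - x + x = x.
Proof. exact: (rss_regular (wlsb_add brS)). Qed.
Let mulVK x : x * x^* * x = x.
Proof. exact: (rss_regular (wlsb_mul brS)). Qed.
Let distr x y z : x * (y + z) = x * y - x + x * z.
Proof. exact: (wlsb_distr brS). Qed.
Let addNx x : - x + x = x * x^*.
Proof. exact: (wlsb_compat brS). Qed.

Lemma addNKN x : - x + x - x = - x.
Proof. by have := addNK (- x); rewrite oppK. Qed.

Lemma mulVKV x : x^* * x * x^* = x^*.
Proof. by have := mulVK (x^*); rewrite starK. Qed.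

Lemma add_mulxV x : x + x * x^* = x.
Proof. by rewrite -addNx addA addNK. Qed.

Lemma mulxV_opp x : x * x^* - x = - x.
Proof. by rewrite -addNx addNKN. Qed.

Lemma add2l u v w t : u + v = w -> t + u + v = t + w.
Proof. by move=> <-; rewrite addA. Qed.

Lemma mul2l u v w t : u * v = w -> t * u * v = t * w.
Proof. by move=> <-; rewrite mulA. Qed.

(** * Projections: the self-adjoint idempotents, shared by both operations *)

Definition proj e := e * e^* = e.

Lemma proj_star e : proj e -> e^* = e.
Proof. by move=> pe; rewrite -{1}pe starM starK. Qed.

Lemma proj_mulxx e : proj e -> e * e = e.
Proof. by move=> pe; rewrite -{2}(proj_star pe). Qed.

Lemma proj_opp e : proj e -> - e = e.
Proof.
move=> pe; have ee : - e + e = e by rewrite addNx.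
by rewrite -{1}ee oppD oppK.
Qed.

Lemma proj_addxx e : proj e -> e + e = e.
Proof. by move=> pe; rewrite -{1}(proj_opp pe) addNx. Qed.

Lemma proj_mulxV x : proj (x * x^*).
Proof. by rewrite /proj starM starK mulA mulVK. Qed.

Lemma proj_mulVx x : proj (x^* * x).
Proof. by have := proj_mulxV (x^*); rewrite starK. Qed.

Lemma proj_addNx x : proj (- x + x).
Proof. by rewrite addNx; apply: proj_mulxV. Qed.

Lemma proj_addxN x : proj (x - x).
Proof. by have := proj_addNx (- x); rewrite oppK. Qed.

Lemma conj_addE e x : proj e -> - x + e + x = - (e + x) + (e + x).
Proof.
by move=> pe; rewrite oppD (proj_opp pe) !addA (add2l _ (proj_addxx pe)).
Qed.

Lemma proj_conj_add e x : proj e -> proj (- x + e + x).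
Proof. by move=> pe; rewrite conj_addE //; apply: proj_addNx. Qed.

Lemma proj_sandwich e f : proj e -> proj f -> proj (e + f + e).
Proof. by move=> pe pf; rewrite -{1}(proj_opp pe); apply: proj_conj_add. Qed.

Lemma conj_mulE e x : proj e -> x * e * x^* = (x * e) * (x * e)^*.
Proof.
by move=> pe; rewrite starM (proj_star pe) !mulA (mul2l _ (proj_mulxx pe)).
Qed.

Lemma proj_conj_mul e x : proj e -> proj (x * e * x^*).
Proof. by move=> pe; rewrite conj_mulE //; apply: proj_mulxV. Qed.


(** * The maps [lam x] and their values on projections *)

Definition lam x y := x * (x^* + y).

Lemma lamE x y : lam x y = - x + x * y.
Proof. by rewrite /lam distr mulxV_opp. Qed.

Lemma lamD x y z : lam x (y + z) = lam x y + lam x z.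
Proof. by rewrite !lamE distr !addA. Qed.

Lemma mul_idem x e : proj e -> x * e - x + x * e = x * e.
Proof. by move=> pe; rewrite -distr proj_addxx. Qed.

Lemma mul_domain_add x y : x * (x^* * x + y) = x - x + x * y.
Proof. by rewrite distr mulA mulVK. Qed.

Lemma mul_sandwich x e : proj e -> x * (e + x^* * x + e) = x * e.
Proof.
move=> pe; rewrite -addA distr mul_domain_add !addA -[x * e - x + x]addA.
by rewrite -[x * e + _ - x]addA addNKN mul_idem.
Qed.

(** Compatibility gives [(x^* + e) * (x^* + e)^* = e + x^* * x + e]; under left multiplication by
    [x], [mul_sandwich] drops the two extra terms. *)
Lemma lam_proj_mulxV x e : proj e -> lam x e * (lam x e)^* = x * e * x^*.
Proof.
move=> pe; rewrite /lam starM !mulA -[x * _ * _]mulA -addNx oppD (proj_opp pe).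
by rewrite !addA -[e - x^* + x^*]addA addNx starK mul_sandwich.
Qed.

Lemma lam_proj_mulK x e : proj e -> x * e * x^* * lam x e = lam x e.
Proof. by move=> pe; rewrite -lam_proj_mulxV // mulVK. Qed.

Lemma lam_proj_addr x e : proj e -> lam x e + x * e * x^* = lam x e.
Proof. by move=> pe; rewrite -lam_proj_mulxV // add_mulxV. Qed.

(** Multiplying [g + e = g] by [g] gives [lam g e = g], hence [g * e * g = g]; multiplying
    [e + g = g] by [g] then gives [g * e = g], and the star reverses it. *)
Lemma mul_sandwich_absorb e f : proj e -> proj f ->
  e * (e + f + e) = e + f + e.
Proof.
move=> pe pf; set g := e + f + e.
have pg : proj g by apply: proj_sandwich.
have ge1 : g + e = g by rewrite /g -addA proj_addxx.
have eg1 : e + g = g by rewrite /g !addA proj_addxx.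
have g_lam : lam g e = g.
  have := congr1 (mul g) ge1.
  rewrite distr (proj_mulxx pg) (proj_opp pg) (proj_addxx pg) => gE.
  by rewrite lamE proj_opp.
have geg : g * e * g = g.
  by have := lam_proj_mulxV g pe; rewrite g_lam (proj_star pg) (proj_mulxx pg).
have ge : g * e = g.
  rewrite -(add_mulxV (g * e)) starM (proj_star pe) (proj_star pg) mulA.
  rewrite (mul2l _ (proj_mulxx pe)) geg.
  have := congr1 (mul g) eg1.
  by rewrite distr (proj_mulxx pg) (proj_opp pg) (add2l _ (proj_addxx pg)).
by rewrite -[LHS]starK starM (proj_star pg) (proj_star pe) ge (proj_star pg).
Qed.

(** The multiplicative order on projections implies the additive one: [m + k] and [k + m] both equal
    [k], while [m + k + m = m]. *)
Lemma proj_sandwich_le e k : proj e -> proj k -> e * k = k -> e + k + e = k.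
Proof.
move=> pe pk ek.
have ke : k * e = k by have := congr1 star ek; rewrite starM !proj_star.
have sandwichE a b : proj a -> proj b -> a * (b + a + b) = a * b.
  by move=> pa pb; have := mul_sandwich a pb; rewrite proj_star // proj_mulxx.
set m := e + k + e.
have pm : proj m by apply: proj_sandwich.
have km : k * m = k by rewrite sandwichE // ke.
have mk : m * k = k by have := congr1 star km; rewrite starM !proj_star.
have kmk : k + m + k = k.
  have kn := mul_sandwich_absorb pk pm.
  by rewrite -{}kn -{1}mk -mulA (mul_sandwich_absorb pk pm) sandwichE.
have y_proj : (m + k) * (m + k)^* = k.
  by rewrite -addNx oppD !proj_opp // addA (add2l _ (proj_addxx pm)).
(* By [y_proj], left multiplication by [k] fixes [m + k]. *)
have mk_add : m + k = k.
  rewrite -[LHS]mulVK y_proj distr km (proj_opp pk) (proj_mulxx pk).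
  by rewrite !proj_addxx.
have km_add : k + m = k.
  by rewrite -{1}(proj_opp pk) -{1}(proj_opp pm) -oppD mk_add proj_opp.
have mkm : m + k + m = m.
  by rewrite -[RHS]/(e + k + e) -[in RHS]kmk /m !addA.
by rewrite -/m -mkm mk_add km_add.
Qed.

(** The element [p = lam e f] satisfies [p * p^* = e * f * e]. It also equals [e + f + e], which is
    a projection, so [p = p * p^*]. *)
Lemma lam_proj_sandwich e f : proj e -> proj f ->
  e + e * f = e * f * e /\ e + f + e = e * f * e.
Proof.
move=> pe pf; set k := e * f * e; set p := e + e * f.
have pk : proj k by rewrite /k -{2}(proj_star pe); apply: proj_conj_mul.
have pE : lam e f = p by rewrite lamE proj_opp.
have ek : e * k = k by rewrite /k !mulA proj_mulxx.
have eke := proj_sandwich_le pe pk ek.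
have ke : k + e = k by rewrite -eke (add2l _ (proj_addxx pe)).
have pke : p + k = p.
  by have := lam_proj_addr e pf; rewrite pE (proj_star pe).
have pp : p * p^* = k.
  by have := lam_proj_mulxV e pf; rewrite pE (proj_star pe).
have gp : e + f + e = p.
  rewrite -(mul_sandwich_absorb pe pf) -addA distr distr !proj_mulxx //.
  by rewrite proj_opp // !addA (add2l _ (proj_addxx pe)) proj_addxx // -/p -pke -addA ke.
have pq : p = k.
  by rewrite -pp -gp; have := proj_sandwich pe pf; rewrite /proj => ->.
by rewrite gp.
Qed.

(** Both sides are fixed by left multiplication by [x * x^*], so it suffices to compare them after
    multiplying by [z = x^*]. Since [q * p = p], one gets [z * p = k * (z + k)], which collapses to
    [k * z = z * q]. *)
Lemma lam_proj x e : proj e -> lam x e = x * e * x^*.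
Proof.
move=> pe; set p := lam x e; set q := x * e * x^*; set z := x^*.
set f := z * x; set k := f * e * f.
have pf : proj f by apply: proj_mulVx.
have pk : proj k by rewrite /k -{2}(proj_star pf); apply: proj_conj_mul.
have fz : f * z = z by rewrite /f /z mulVKV.
have xzp : x * z * p = p by rewrite /p /lam mulA mulVK.
have xzq : x * z * q = q by rewrite /q !mulA mulVK.
have zp : z * p = z + k.
  rewrite /p /lam mulA -/z -/f distr fz (proj_opp pf).
  by rewrite -addA (lam_proj_sandwich pf pe).1.
have kz : k * z = z * q by rewrite /k -(mulA _ f z) fz /q !mulA.
have kzp : k * (z + k) = k * z.
  rewrite distr (proj_opp pk) (proj_mulxx pk) -addA (proj_addxx pk).
  have kzk : k * z * (k * z)^* = k.
    rewrite starM (proj_star pk) mulA -(mulA k z) /z starK -/z -/f.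
    by rewrite {1}/k -(mulA _ f f) proj_mulxx // -/k proj_mulxx.
  by rewrite -{2}kzk add_mulxV.
have zpq : z * p = z * q.
  by rewrite -kz -kzp -zp mulA kz -mulA lam_proj_mulK.
by rewrite -xzp -mulA zpq mulA.
Qed.

(** * Left multiplication by a projection as addition on the right *)

Lemma mul_proj_add f w : proj f -> f * w = w + f.
Proof.
move=> pf; have [_ sE] := lam_proj_sandwich pf (proj_mulxV w).
have ss : (w + f) * (w + f)^* = f * (w * w^*) * f.
  by rewrite -addNx oppD proj_opp // -sE !addA -[f - w + w]addA addNx.
have fs : f * (w + f) = w + f.
  by rewrite -(mulVK (w + f)) ss !mulA proj_mulxx.
rewrite -fs distr (proj_opp pf) (proj_mulxx pf) -addA proj_addxx //.
(* The projection that [f * w] absorbs on the right is [f + w * w^* + f], which ends in [f]. *)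
rewrite -[f * w]add_mulxV starM (proj_star pf) !mulA -[f * w * _]mulA.
by rewrite -sE !addA (add2l _ (proj_addxx pf)).
Qed.

(** This is distributivity for [f * (w + z)], with each product by [f] read as adding [f] on the
    right. *)
Lemma add_projr w z f : proj f -> w + z + f = w + f + z + f.
Proof.
move=> pf; rewrite -mul_proj_add // distr !mul_proj_add // proj_opp //.
by rewrite !addA (add2l _ (proj_addxx pf)).
Qed.

Lemma add_projl w z f : proj f -> f + w + z = f + w + f + z.
Proof.
move=> pf; apply: (can_inj oppK).
by rewrite !oppD (proj_opp pf) !addA add_projr.
Qed.

(** * The compressed monoids [h + S + h] *)

Definition local h t := h + t = t /\ t + h = t.

Lemma localD h s t : local h s -> local h t -> local h (s + t).
Proof. by case=> hs _ [_ th]; split; rewrite ?addA ?hs // -addA th. Qed.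

Lemma localN h t : proj h -> local h t -> local h (- t).
Proof.
move=> ph [ht th].
by split; rewrite -{1}(proj_opp ph) -oppD ?ht ?th.
Qed.

Lemma local_compress h t : proj h -> local h (h + t + h).
Proof.
by move=> ph; split; rewrite ?addA ?(proj_addxx ph) // -addA proj_addxx.
Qed.

Lemma proj_le_local e k : proj e -> proj k -> e * k = k -> local e k.
Proof.
move=> pe pk ek; rewrite -(proj_sandwich_le pe pk ek).
exact: local_compress.
Qed.

(** Both sides equal [e + t + e]: writing [t] as [t + h] or [h + t] lets a second [e] be inserted
    beside [h], which it absorbs. *)
Lemma local_proj_central h e t : proj h -> proj e -> local h e -> local h t ->
  e + t = t + e.
Proof.
move=> ph pe [he eh] [ht th].
have ete : e + t + e = e + t.
  by rewrite -[in RHS]th addA [RHS]add_projl // -[RHS]addA eh.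
by rewrite -ete -[in RHS]ht [RHS]add_projr // he.
Qed.

Lemma local_proj_conj h e t : proj h -> proj e -> local h t ->
  - t + e + t = h + e + h + (- t + t).
Proof.
move=> ph pe lt; have [ht th] := lt; have [hNt Nth] := localN ph lt.
have le := local_compress e ph; have pe' := proj_sandwich ph pe.
have -> : - t + e + t = - t + (h + e + h) + t.
  by rewrite !addA Nth -(addA _ h) ht.
by rewrite -(local_proj_central ph pe' le (localN ph lt)) addA.
Qed.

(** The projections [t - t] and [- t + t] absorb each other, and they commute by centrality. *)
Lemma local_addxN h t : proj h -> local h t -> t - t = - t + t.
Proof.
move=> ph lt; have lNt := localN ph lt.
have lP : local h (- t + t) by apply: localD.
have lQ : local h (t - t) by apply: localD.
have CP := local_proj_central ph (proj_addNx t) lP.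
have CQ := local_proj_central ph (proj_addxN t) lQ.
have QP : t - t + (- t + t) = t - t by rewrite -addA -(CP _ lNt) addNKN.
have PQ : - t + t + (t - t) = - t + t by rewrite -addA -(CQ _ lt) addNK.
by rewrite -QP -(CP _ lQ) PQ.
Qed.

(* Compressed to [K + S + K] with [K = - a + a], both [- a] and [b] become
   inverses of [K + a + K], and that inverse is unique. *)
Lemma opp_add_inverse a b z : b + a = - a + a -> b + a + b = b ->
  - a + z = b + z.
Proof.
move=> ba bab; have [K KE] : {K | K = - a + a} by exists (- a + a).
have pK : proj K by rewrite KE; apply: proj_addNx.
have aK : a + K = a by rewrite KE addA addNK.
have Kb : K + b = b by rewrite KE -ba.
have KNa : K - a = - a by rewrite KE addNKN.
suff NaE : K - a + K = K + b + K.
  by rewrite -KNa -[in RHS]Kb [LHS]add_projl // NaE [RHS]add_projl.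
set a' := K + a + K; set al := K - a + K; set be := K + b + K.
have la : local K a' by apply: local_compress.
have lal : local K al by apply: local_compress.
have lbe : local K be by apply: local_compress.
have alE : al = - a' by rewrite /al /a' !oppD (proj_opp pK) addA.
have compress_add c : K + c + K + (K + a + K) = K + (c + a) + K.
  by rewrite !addA (add2l _ (proj_addxx pK)) -add_projl.
have bea : be + a' = K.
  by rewrite /be /a' compress_add ba -KE !proj_addxx.
have ala : al + a' = K.
  by rewrite /al /a' compress_add -KE !proj_addxx.
have aal : a' + al = K by rewrite alE (local_addxN pK la) -alE.
by rewrite -[al]lal.1 -bea -addA aal lbe.2.
Qed.

(** * The action [lam], the maps [rho] and the outer components *)

Lemma lam_mul x y w : lam x (lam y w) = lam (x * y) w.
Proof.
rewrite !lamE distr !addA -(mulA x y w).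
(* Here [a] is [x * y] and [b] is [- x + x * - y - x], the part of the expanded left-hand side
   before [x * y * w]. *)
apply/esym/opp_add_inverse.
  have -> : - x + x * - y - x + x * y = lam x (- y + y).
    by rewrite lamE distr !addA.
  by rewrite addNx lam_proj ?addNx ?starM ?mulA //; apply: proj_mulxV.
have -> : - x + x * - y - x + x * y + (- x + x * - y - x)
          = - x + x * (- y + y - y) - x by rewrite !distr !addA.
by rewrite addNKN.
Qed.

Definition rho y x := (x^* + y)^* * y.

(** With [t = x^* + y] the product is [x * t * t^* * y], where [t * t^* = - y + x^* * x + y];
    distributivity turns [x * t * t^*] into [x * y * y^*]. *)
Lemma lam_mul_rho x y : lam x y * rho y x = x * y.
Proof.
have conjE : x * (- y + x^* * x + y) = x * y * y^*.
  rewrite -addA distr mul_domain_add !addA -(addA _ (- x) x) -(addA _ _ (- x)).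
  by rewrite addNKN -distr addNx mulA.
rewrite /lam /rho mulA -(mulA x) -addNx oppD !addA -(addA (- y)) addNx starK.
by rewrite conjE -!(mulA x) mulVK.
Qed.

Lemma lam_lam_rho x y z : lam (lam x y) (lam (rho y x) z) = lam x (lam y z).
Proof. by rewrite !lam_mul lam_mul_rho. Qed.

Lemma mul_starl z u v : z^* * u = z^* * v -> u^* * z = v^* * z.
Proof. by move=> /(congr1 star); rewrite !starM starK. Qed.

Lemma mul_add_lam x y z : x * y + lam x z = x * (y + z).
Proof. by rewrite lamE distr addA. Qed.

(** Both [lam z^* n] and [lam z^* z] lie in the compressed monoid at [z^* * z], where the former is
    a projection and hence central. *)
Lemma lam_star_comm z n : proj n -> lam z^* (n + z) = lam z^* (z + n).
Proof.
move=> pn; rewrite !lamD (lam_proj _ pn) starK.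
have ps := proj_mulVx z.
have pP : proj (z^* * n * z) by rewrite -{2}(starK z); apply: proj_conj_mul.
apply: (local_proj_central ps) => //.
  by apply: proj_le_local; rewrite // !mulA mulVKV.
have sNz : z^* * z - z^* = - z^* by rewrite -{2}(starK z) mulxV_opp.
by rewrite lamE; split; rewrite ?addA ?sNz // -addA proj_addxx.
Qed.

Lemma rho_rho x y z : rho z (rho y x) = rho (y * z) x.
Proof.
rewrite /rho !starM starK mulA -[_ * y]starK starM starK; apply: mul_starl.
(* The two sums under [z^*] both start with [y^* * x^* - y^*] and end with [y^* * y] and [z], in
   opposite orders. *)
rewrite !(distr y^*) (mulA y^*) (mul_proj_add z (proj_mulVx y)).
rewrite -(addA _ (y^* * y)) -!(mul_add_lam z^*).
by rewrite lam_star_comm //; apply: proj_mulVx.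
Qed.

Lemma rho_rho_lam x y z : rho (rho z y) (rho (lam y z) x) = rho z (rho y x).
Proof. by rewrite !rho_rho lam_mul_rho. Qed.

(** * The middle component *)

Lemma add_compress x h f t : x + f = x -> proj h -> proj f -> local h t ->
  x + t = x + (h + f + h) + t.
Proof.
move=> xf ph pf [ht _].
have fht : f + h + t = f + (h + f + h) + t.
  by rewrite add_projl // -[in LHS]ht !addA.
by rewrite -{1}xf -addA -{1}ht (addA f) fht !addA xf.
Qed.

Lemma add_local x h t : proj h -> t + h = t -> x + t = x + (h + t).
Proof. by move=> ph th; rewrite -{1}th addA add_projr // -!addA th. Qed.

Lemma local_addNxD h s t : proj h -> local h s -> local h t ->
  - (s + t) + (s + t) = - s + s + (- t + t).
Proof.
move=> ph ls lt.
have lP : local h (- s + s) by apply: localD => //; apply: localN.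
rewrite oppD !addA -(addA (- t)) (local_proj_conj ph (proj_addNx s) lt).
by rewrite lP.1 lP.2 addA.
Qed.

(** Projections in the compressed monoid are central and [- p + p = Y + C], so both sides collapse
    to [e + Y + c + C]. *)
Lemma local_sum h e y c : proj h -> proj e ->
    local h e -> local h y -> local h c ->
  let p := - y + c in
  e + (y + p + (e + (- y + y)) + (e + (- p + p))) =
  e + (p - p + c + (e + (- p + p))).
Proof.
move=> ph pe le ly lc p; have lNy := localN ph ly; have lNc := localN ph lc.
have [Y YE] : {Y | Y = - y + y} by exists (- y + y).
have pY : proj Y by rewrite YE; apply: proj_addNx.
have lY : local h Y by rewrite YE; apply: localD.
have [C CE] : {C | C = - c + c} by exists (- c + c).
have pC : proj C by rewrite CE; apply: proj_addNx.
have lC : local h C by rewrite CE; apply: localD.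
have lp : local h p by apply: localD.
have ppE : - p + p = Y + C.
  by rewrite /p (local_addNxD ph lNy lc) oppK (local_addxN ph ly) CE YE.
rewrite (local_addxN ph lp) ppE /p (addA y) (local_addxN ph ly) -YE.
have absorb f t : proj f -> local h f -> local h t -> f + t + f = f + t.
  move=> pf lf lt.
  by rewrite -addA -(local_proj_central ph pf lf lt) addA proj_addxx.
have Cc : C + c = c by rewrite (local_proj_central ph pC lC lc) CE addA addNK.
have We : e + Y + c + e = e + Y + c.
  by rewrite -(addA e) absorb //; apply: localD.
have WY : e + Y + c + Y = e + Y + c by rewrite -!(addA e) absorb.
by rewrite !addA -(addA _ C c) Cc !(We, WY).
Qed.

(** Everything after [x^*] is moved into the compressed monoid at [h]: [y], [y * z] and [x^* * x]
    become [y'], [c] and [F]. Since [x^*] absorbs [x^* * x], [F] may be inserted right after it,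
    which leaves [local_sum]. *)
Lemma middle_sum x y z p K L :
    p = - y + y * z -> K = - y + x^* * x + y -> L = - p + x^* * x + p ->
  x^* + y + p + K + L = x^* + p - p + y * z + L.
Proof.
move=> pdef Kdef Ldef.
have [f fE] : {f | f = x^* * x} by exists (x^* * x).
have [h hE] : {h | h = y * y^*} by exists (y * y^*).
have [y' yE] : {y' | y' = h + y} by exists (h + y).
have [c cE] : {c | c = h + y * z} by exists (h + y * z).
have [F FE] : {F | F = h + f + h} by exists (h + f + h).
have pf : proj f by rewrite fE; apply: proj_mulVx.
have ph : proj h by rewrite hE; apply: proj_mulxV.
have pF : proj F by rewrite FE; apply: proj_sandwich.
have yh : y + h = y by rewrite hE add_mulxV.
have hNy : h - y = - y by rewrite hE mulxV_opp.
have yzh : y * z + h = y * z by rewrite -mul_proj_add // hE mulA mulVK.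
have ly : local h y'.
  by split; rewrite yE ?addA ?proj_addxx // -addA yh.
have lc : local h c by split; rewrite cE ?addA ?proj_addxx // -addA yzh.
have lF : local h F by rewrite FE; apply: local_compress.
have pE : p = - y' + c.
  rewrite pdef -hNy add_projl // hNy yE cE oppD (proj_opp ph) !addA.
  by rewrite (add2l _ (proj_addxx ph)).
have lp : local h p by rewrite pE; apply: localD => //; apply: localN.
have KE : K = F + (- y' + y').
  rewrite FE -(local_proj_conj ph pf ly) Kdef -fE yE oppD (proj_opp ph) !addA.
  have hl w : - y + w = - y + h + w by rewrite -hNy [LHS]add_projl.
  have hr w : w + y = w + h + y by rewrite -yh !addA [LHS]add_projr.
  by rewrite -addA hl !addA hr.
have LE : L = F + (- p + p) by rewrite FE Ldef -fE; apply: local_proj_conj.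
have lL : local h L by rewrite LE; do !apply: localD => //; apply: localN.
have lK : local h K by rewrite KE; do !apply: localD => //; apply: localN.
have lNp := localN ph lp.
have xt t : local h t -> x^* + t = x^* + (F + t).
  rewrite FE addA.
  by apply: add_compress => //; rewrite fE -{3}(starK x) add_mulxV.
have lhsE : x^* + y + p + K + L = x^* + (y' + p + K + L).
  rewrite yE -!addA; apply: add_local => //.
  by rewrite -!addA lL.2.
have rhsE : x^* + p - p + y * z + L = x^* + (p - p + c + L).
  have hl w : - p + w = - p + (h + w) by rewrite addA -lNp.1 [LHS]add_projl.
  by rewrite cE -!addA hl.
have lR : local h (p - p + c + L) by do !apply: localD.
have lLHS : local h (y' + p + K + L) by do !apply: localD.
rewrite lhsE rhsE xt // [RHS]xt // KE LE pE.
by congr (x^* + _); apply: (local_sum ph).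
Qed.

Lemma rho_lam x y z :
  rho (lam (rho y x) z) (lam x y) = lam (rho (lam y z) x) (rho z y).
Proof.
set p := lam y z.
have lam_v : lam (rho y x) z = lam (x^* + y)^* p by rewrite /rho -lam_mul.
have lam_w : lam (rho p x) (rho z y) = lam (x^* + p)^* (- p + y * z).
  by rewrite /rho -lam_mul [lam p _]lamE lam_mul_rho.
have sum_conj u : - u + x^* * x + u = (x^* + u) * (x^* + u)^*.
  by rewrite -addNx oppD !addA -(addA _ _ x^*) addNx starK.
rewrite lam_w lam_v /rho [lam x y]/lam starM mul_add_lam starM starK.
rewrite /lam !starK.
(* With [t = x^* + p], expanding [t^*] as [t^* * t * t^*] leaves the projection [t * t^*] on both
   sides after [t^*] is stripped; it and the projection of [x^* + y] then act by addition on the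
   right. *)
rewrite -[(x^* + p)^*]mulVKV -!mulA; congr (_ * _).
rewrite (mulA (x^* + y)) !(mulA (x^* + p)) -!sum_conj.
have conj_mul u w : (- u + x^* * x + u) * w = w + (- u + x^* * x + u).
  exact/mul_proj_add/proj_conj_add/proj_mulVx.
by rewrite !conj_mul !(addA (x^* + p)); apply: middle_sum => //; apply: lamE.
Qed.

End WeakLeftStarBrace.

Theorem theorem5p23 (S : Type) (add mul : S -> S -> S) (opp star : S -> S)
    (brS : weak_left_star_brace add mul opp star) :
  yang_baxter_solution (brace_map add mul star).
Proof.
case=> [[x y] z] /=; congr (_, _, _).
- exact: (lam_lam_rho brS).
- exact: (rho_lam brS).
- by symmetry; exact: (rho_rho_lam brS).
Qed.
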